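(* Let $A=(a_{jn})$ be a non-negative regular summability matrix, let $K=[0,\infty)\times[0,\infty)$, and let $\{L_n\}$ be a sequence of positive linear operators from $H_{w_2}$ into $C_B(K)$. Then, for any $f\in H_{w_2}$, $$st_A\text{-}\lim_n\|L_nf-f\|=0$$ is satisfied if the following holds: $$st_A\text{-}\lim_n\|L_nf_i-f_i\|=0,\qquad i=0,1,2,3,$$ where $$f_0(u,v)=1,\quad f_1(u,v)=\frac{u}{1+u},\quad f_2(u,v)=\frac{v}{1+v},\quad f_3(u,v)=\left(\frac{u}{1+u}\right)^2+\left(\frac{v}{1+v}\right)^2 .$$
   Context: **Summability.** For an infinite summability matrix $A=(a_{jn})$ and a sequence $x=(x_n)$, the $A$-transform $Ax=((Ax)_j)$ is given by $(Ax)_j=\sum_{n=1}^\infty a_{jn}x_n$, provided the series converges for each $j\in\mathbb{N}$. $A$ is *regular* if $\lim Ax=L$ whenever $\lim x=L$. $A$ is non-negative if all $a_{jn}\ge 0$. For a non-negative regular summability matrix $A$, the sequence $x=(x_n)$ is *$A$-statistically convergent to $L$*, written $st_A\text{-}\lim_n x_n=L$, if for every $\varepsilon>0$, $$\lim_j\sum_{n:\,|x_n-L|\ge\varepsilon}a_{jn}=0 .$$ **Function spaces.** $C_B(K)$ is the space of real-valued continuous and bounded functions on $K=[0,\infty)\times[0,\infty)$, with the sup norm $\|f\|=\sup_{(x,y)\in K}|f(x,y)|$. The modulus of continuity of a real-valued function $f$ on $K$ is, for any $\delta_1,\delta_2>0$, $$w_2(f;\delta_1,\delta_2)=\sup\{|f(u,v)-f(x,y)|:\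 (u,v),(x,y)\in K,\ |u-x|\le\delta_1,\ |v-y|\le\delta_2\},$$ the same formula being used when a $\delta_i$ equals $0$. $H_{w_2}$ is the space of all real-valued functions $f$ defined on $K$ and satisfying, for all $(u,v),(x,y)\in K$, $$|f(u,v)-f(x,y)|\le w_2\left(f;\left|\frac{u}{1+u}-\frac{x}{1+x}\right|,\left|\frac{v}{1+v}-\frac{y}{1+y}\right|\right).$$ **Operators.** A linear operator $L$ from $H_{w_2}$ into $C_B(K)$ is *positive* if $f\ge 0$ implies $Lf\ge 0$, for $f\in H_{w_2}$.
   Formalization: In the definition of H_{w_2}, the bound w_2(f;·,·) is replaced by w_2(g;·,·) for some function g on K with w_2(g;δ1,δ2)→0 as δ1,δ2→0+; as written, f_1 is not in H_{w_2} (1/2 > w_2(f_1;1/2,0) = 1/3), so L_n f_1 is undefined. *)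

(* Defs.v *)
From HB Require Import structures.
From mathcomp Require Import all_boot all_order all_algebra.
From mathcomp Require Import all_classical all_reals all_analysis.

Set Implicit Arguments.
Unset Strict Implicit.
Unset Printing Implicit Defensive.

Import Order.TTheory GRing.Theory Num.Theory.
Import numFieldNormedType.Exports.

Local Open Scope classical_set_scope.
Local Open Scope ring_scope.

(* Matrices and sequences are indexed from 0 rather than from 1. *)

Definition regular_matrix (R : realType) (A : nat -> nat -> R) : Prop :=
  forall (x : nat -> R) (l : R), x @ \oo --> l ->
    (forall j, cvgn (fun N => \sum_(0 <= n < N) A j n * x n)) /\
    (fun j => limn (fun N => \sum_(0 <= n < N) A j n * x n)) @ \oo --> l.

(* For a non-negative regular A the inner series is dominated by the
   convergent series of row j, so its limit is the actual sum. *)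
Definition A_stat_cvg (R : realType) (A : nat -> nat -> R)
    (x : nat -> R) (l : R) : Prop :=
  forall e : R, 0 < e ->
    (fun j => limn (fun N => \sum_(0 <= n < N | e <= `|x n - l|) A j n)) @ \oo --> (0 : R).

(* A function on K is represented by a function on R * R of which only the
   values on K are ever used. *)
Definition K {R : realType} : set (R * R) :=
  [set p | 0 <= p.1 /\ 0 <= p.2].

Definition C_B (R : realType) (f : R * R -> R) : Prop :=
  {within K, continuous f} /\ exists M : R, forall p, K p -> `|f p| <= M.

Definition supnorm (R : realType) (f : R * R -> R) : R :=
  sup [set `|f p| | p in K].

Definition w2 (R : realType) (f : R * R -> R) (d1 d2 : R) : \bar R :=
  ereal_sup [set r | exists p q : R * R,
    [/\ K p, K q, `|p.1 - q.1| <= d1, `|p.2 - q.2| <= d2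
      & r = `|f p - f q|%:E]].

(* The inequality defining H_{w_2} is required with the modulus of continuity
   w2 g of some g such that w2 g d1 d2 tends to 0 with d1, d2.  Literally
   taking g := f would be degenerate: as
     |u/(1+u) - x/(1+x)| <= |u - x| / (1 + |u - x|),
   the function u/(1+u) violates the inequality, and the only f that satisfy
   it and have w2 f vanishing at 0 are the constants; without the vanishing
   condition sin(u^2), or the indicator function of the rational points,
   satisfies it. *)
Definition H_w2 (R : realType) (f : R * R -> R) : Prop :=
  exists2 g : R * R -> R,
    w2 g d.1 d.2 @[d --> filter_prod (0 : R)^'+ (0 : R)^'+] --> 0%E &
    forall u v x y : R, K (u, v) -> K (x, y) ->
      (`|f (u, v) - f (x, y)|%:E <=
       w2 g `|u / (1 + u) - x / (1 + x)|%R `|v / (1 + v) - y / (1 + y)|%R)%E.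

(* Positivity and linearity together imply that the values of L f on K depend
   only on those of f on K. *)
Definition positive_linear_operator (R : realType)
    (L : (R * R -> R) -> (R * R -> R)) : Prop :=
  [/\ forall f, H_w2 f -> C_B (L f),
      forall (a b : R) f g, H_w2 f -> H_w2 g -> forall p, K p ->
        L (fun q => a * f q + b * g q) p = a * L f p + b * L g p
    & forall f, H_w2 f -> (forall p, K p -> 0 <= f p) ->
        forall p, K p -> 0 <= L f p].

Definition f0 {R : realType} (p : R * R) : R := 1.
Definition f1 {R : realType} (p : R * R) : R := p.1 / (1 + p.1).
Definition f2 {R : realType} (p : R * R) : R := p.2 / (1 + p.2).
Definition f3 {R : realType} (p : R * R) : R :=
  (p.1 / (1 + p.1)) ^+ 2 + (p.2 / (1 + p.2)) ^+ 2.

(* Main.v *)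
(* Korovkin's argument.  A function f of H_w2 is bounded and uniformly continuous
   on K in the variables s = u/(1+u), t = v/(1+v), so that
     |f q - f p| <= e + C ((s_q - s_p)^2 + (t_q - t_p)^2)
   for all p, q in K.  The right-hand side is a combination of f0, ..., f3 in q;
   applying L_n and evaluating at p gives, by positivity,
     ||L_n f - f|| <= e + B (||L_n f0 - f0|| + ... + ||L_n f3 - f3||)
   with B independent of n.  Hence the indices n with ||L_n f - f|| >= 2e lie in
   a finite union of sets of A-density zero.  Positivity is available only inside
   H_w2, whose definition uses a modulus w2 g, so H_w2 must be shown stable under
   linear combinations. *)
Require Import Defs.
From HB Require Import structures.
From mathcomp Require Import all_boot all_order all_algebra.
From mathcomp Require Import all_classical all_reals all_analysis.
From mathcomp Require Import ring lra.

Set Implicit Arguments.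
Unset Strict Implicit.
Unset Printing Implicit Defensive.

Import Order.TTheory GRing.Theory Num.Theory.
Import numFieldNormedType.Exports.

Local Open Scope classical_set_scope.
Local Open Scope ring_scope.

(* By H_w2P below, on K this is uniform continuity in the variables
   u/(1+u), v/(1+v), that is, membership in H_w2.  Unlike the latter, it is
   visibly stable under sums. *)
Definition almost_lipschitz (R : realType) (f : R * R -> R) : Prop :=
  forall e : R, 0 < e -> exists2 C : R, 0 <= C &
    forall p q, K p -> K q ->
      `|f p - f q| <= e + C * (`|f1 p - f1 q| + `|f2 p - f2 q|).

(** * The change of variables from [K] to the square [0,1)^2 *)

Lemma ratio_itv (R : realType) (u : R) : 0 <= u -> 0 <= u / (1 + u) < 1.
Proof.
move=> u0; have u1 : 0 < 1 + u by lra.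
by rewrite divr_ge0 ?(ltW u1)//= ltr_pdivrMr// mul1r ltrDr.
Qed.

Lemma ratio_onto (R : realType) (s : R) : 0 <= s < 1 ->
  exists2 u, 0 <= u & u / (1 + u) = s.
Proof.
move=> /andP[s0 s1]; exists (s / (1 - s)); first by rewrite divr_ge0//; lra.
by field; apply/andP; split; lra.
Qed.

Lemma f1_itv (R : realType) (p : R * R) : K p -> 0 <= f1 p < 1.
Proof. by case=> ? _; exact: ratio_itv. Qed.

Lemma f2_itv (R : realType) (p : R * R) : K p -> 0 <= f2 p < 1.
Proof. by case=> _ ?; exact: ratio_itv. Qed.

(** The map ([f1], [f2]) sends [K] onto the convex set [0,1)^2. This permits bisection in the new
    variables. *)
Lemma K_midpoint (R : realType) (p q : R * R) : K p -> K q ->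
  exists m, [/\ K m, f1 m = (f1 p + f1 q) / 2 & f2 m = (f2 p + f2 q) / 2].
Proof.
move=> Kp Kq.
have /andP[? ?] := f1_itv Kp; have /andP[? ?] := f1_itv Kq.
have /andP[? ?] := f2_itv Kp; have /andP[? ?] := f2_itv Kq.
have [|u u0 uE] := @ratio_onto R ((f1 p + f1 q) / 2); first by lra.
have [|v v0 vE] := @ratio_onto R ((f2 p + f2 q) / 2); first by lra.
by exists (u, v); split.
Qed.

(** * From uniform continuity to almost Lipschitz bounds *)

Lemma H_w2_unif_cont (R : realType) (f : R * R -> R) : H_w2 f ->
  forall e : R, 0 < e -> exists2 d : R, 0 < d &
    forall p q, K p -> K q -> `|f1 p - f1 q| <= d -> `|f2 p - f2 q| <= d ->
      `|f p - f q| <= e.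
Proof.
move=> [g /fine_cvgP[gfin g0] fg] e e0.
move: g0 => /cvgr0Pnorm_lt /(_ e e0) g0.
have [[P Q] /= [P0 Q0] PQ] := filterI gfin g0.
have [d [[Pd Qd] d0]] := filter_ex (filterI (filterI P0 Q0) (nbhs_right_gt 0)).
have [/= dfin dlt] := PQ (d, d) (conj Pd Qd).
exists d => // -[u v] [x y] Kp Kq h1 h2.
rewrite -lee_fin; apply: (le_trans (fg _ _ _ _ Kp Kq)).
apply: (@le_trans _ _ (w2 g d d)).
  apply: le_ereal_sup => _ [p [q [? ? h3 h4 ->]]].
  by exists p, q; split => //; [apply: le_trans h3 _|apply: le_trans h4 _].
rewrite -(fineK dfin) lee_fin; apply: ltW; apply: le_lt_trans dlt.
exact: ler_norm.
Qed.

(** The oscillation of [f] on [K] is at most some [M]. At distance at most [d], uniform continuity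
    gives [e]; beyond [d], the slope [M / d] makes the linear term exceed [M]. *)
Lemma H_w2_almost_lipschitz (R : realType) (f : R * R -> R) :
  H_w2 f -> almost_lipschitz f.
Proof.
move=> /H_w2_unif_cont fuc.
have [M M0 fM] : exists2 M, 0 <= M &
    forall p q, K p -> K q -> `|f p - f q| <= M.
  have [d d0 fd] := fuc 1 ltr01.
  (* Each bisection halves the distances and doubles the bound, starting from 1 at scale [d]. *)
  have chain n p q : K p -> K q -> `|f1 p - f1 q| <= 2 ^+ n * d ->
      `|f2 p - f2 q| <= 2 ^+ n * d -> `|f p - f q| <= 2 ^+ n.
    elim: n p q => [|n IH] p q Kp Kq; first by rewrite !expr0 !mul1r; exact: fd.
    rewrite !exprS -!mulrA => h1 h2.
    have [m [Km m1 m2]] := K_midpoint Kp Kq.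
    have half (a b c x : R) : x = (a + b) / 2 -> `|a - b| <= 2 * c ->
        `|a - x| <= c /\ `|x - b| <= c.
      by move=> -> h; split; move: h; rewrite !ler_norml => /andP[? ?]; lra.
    have [h3 h4] := half _ _ _ _ m1 h1; have [h5 h6] := half _ _ _ _ m2 h2.
    have := IH _ _ Kp Km h3 h5; have := IH _ _ Km Kq h4 h6.
    by rewrite !ler_norml => /andP[? ?] /andP[? ?]; lra.
  have [n nd] : exists n : nat, 1 <= 2 ^+ n * d.
    have := archi_boundP (ltW (divr_gt0 ltr01 d0)).
    set n := Num.Def.archi_bound _ => nd; exists n.
    rewrite -ler_pdivrMr//; apply: ltW; apply: (lt_le_trans nd).
    by rewrite -natrX ler_nat ltnW// ltn_expl.
  exists (2 ^+ n) => [|p q Kp Kq]; first exact: exprn_ge0.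
  have /andP[? ?] := f1_itv Kp; have /andP[? ?] := f1_itv Kq.
  have /andP[? ?] := f2_itv Kp; have /andP[? ?] := f2_itv Kq.
  by apply: chain => //; apply: le_trans nd; rewrite ler_norml; lra.
move=> e e0; have [d d0 fd] := fuc e e0.
exists (M / d) => [|p q Kp Kq]; first by rewrite divr_ge0// ltW.
have far (a b : R) : 0 <= b -> d < a -> M <= e + M / d * (a + b).
  move=> b0 da; rewrite mulrAC -[X in X <= _](mulfK (lt0r_neq0 d0)).
  apply: (@le_trans _ _ (M * (a + b) / d)); last by lra.
  by rewrite ler_pM2r ?invr_gt0// ler_wpM2l//; lra.
have [h1|h1] := leP `|f1 p - f1 q| d; last first.
  by apply: (le_trans (fM _ _ Kp Kq)); exact: far.
have [h2|h2] := leP `|f2 p - f2 q| d; last first.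
  apply: (le_trans (fM _ _ Kp Kq)).
  by rewrite [_ + `|f2 _ - _|]addrC; exact: far.
apply: (le_trans (fd _ _ Kp Kq h1 h2)).
by rewrite lerDl mulr_ge0 ?divr_ge0 ?addr_ge0// ltW.
Qed.

(** * A modulus of continuity built from the affine bounds *)

Section Majorant.
Variables (R : realType) (f : R * R -> R).
Hypothesis f_lip : almost_lipschitz f.

Definition affine_bounds (d : R) : set R :=
  [set r | exists e C, [/\ 0 <= e, 0 <= C, r = e + C * d
    & forall p q, K p -> K q ->
      `|f p - f q| <= e + C * (`|f1 p - f1 q| + `|f2 p - f2 q|)]].

(* An infimum of affine functions with non-negative coefficients, hence
   subadditive and non-decreasing; so (u, v) |-> majorant (u + v) has modulus of
   continuity majorant (d1 + d2), which is what H_w2 asks for. *)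
Definition majorant (d : R) : R := inf (affine_bounds d).

Lemma affine_bounds_nonempty d : affine_bounds d !=set0.
Proof.
have [C C0 fC] := f_lip ltr01.
by exists (1 + C * d), 1, C; split.
Qed.

Lemma affine_bounds_has_lbound d : 0 <= d -> has_lbound (affine_bounds d).
Proof.
by move=> d0; exists 0 => _ [e [C [? ? -> _]]]; rewrite addr_ge0 ?mulr_ge0.
Qed.

Lemma le_majorant p q : K p -> K q ->
  `|f p - f q| <= majorant (`|f1 p - f1 q| + `|f2 p - f2 q|).
Proof.
move=> Kp Kq; apply: lb_le_inf; first exact: affine_bounds_nonempty.
by move=> _ [e [C [_ _ -> fC]]]; exact: fC.
Qed.

Lemma majorant_subadd a b h : 0 <= a -> 0 <= b -> 0 <= h -> a <= b + h ->
  majorant a <= majorant b + majorant h.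
Proof.
move=> a0 b0 h0 abh; rewrite -lerBlDr.
apply: lb_le_inf; first exact: affine_bounds_nonempty.
move=> _ [e1 [C1 [e10 C10 -> fC1]]]; rewrite lerBlDr addrC -lerBlDr.
apply: lb_le_inf; first exact: affine_bounds_nonempty.
move=> _ [e2 [C2 [e20 C20 -> fC2]]]; rewrite lerBlDr.
(* Of the two affine bounds, the one with the smaller slope is evaluated at [a]: its constant and
   its slope on one summand are matched exactly, and the larger slope covers the other summand. *)
have [C12|/ltW C12] := leP C1 C2.
  apply: (@le_trans _ _ (e1 + C1 * a)).
    by apply: (ge_inf (affine_bounds_has_lbound a0)); exists e1, C1.
  have : C1 * a <= C1 * (b + h) by rewrite ler_wpM2l.
  have : C1 * h <= C2 * h by rewrite ler_wpM2r.
  by lra.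
apply: (@le_trans _ _ (e2 + C2 * a)).
  by apply: (ge_inf (affine_bounds_has_lbound a0)); exists e2, C2.
have : C2 * a <= C2 * (b + h) by rewrite ler_wpM2l.
have : C2 * b <= C1 * b by rewrite ler_wpM2r.
by lra.
Qed.

Lemma majorant_ge0 d : 0 <= d -> 0 <= majorant d.
Proof.
move=> d0; apply: lb_le_inf; first exact: affine_bounds_nonempty.
by move=> _ [e [C [? ? -> _]]]; rewrite addr_ge0 ?mulr_ge0.
Qed.

Lemma majorant_cvg0 e : 0 < e ->
  exists2 d, 0 < d & forall a, 0 <= a <= d -> majorant a < e.
Proof.
move=> e0; have [C C0 fC] := f_lip (divr_gt0 e0 (ltr0n R 3)).
exists (e / 3 / (C + 1)) => [|a /andP[a0 ad]]; first by rewrite !divr_gt0//; lra.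
apply: (@le_lt_trans _ _ (e / 3 + C * a)).
  apply: (ge_inf (affine_bounds_has_lbound a0)); exists (e / 3), C.
  by split => //; lra.
move: ad; rewrite ler_pdivlMr; last by lra.
by rewrite mulrDr mulr1 [a * C]mulrC; lra.
Qed.

Lemma majorant0 : majorant 0 = 0.
Proof.
apply/eqP; rewrite eq_le majorant_ge0// andbT; apply/ler_addgt0Pl => e e0.
have [d d0 hd] := majorant_cvg0 e0.
by rewrite addr0 ltW// hd// lexx ltW.
Qed.

(** The witness [g] satisfies w2 g d1 d2 = majorant (d1 + d2): subadditivity gives the upper bound,
    and the pair (d1, d2), (0, 0) attains it. *)
Lemma almost_lipschitz_H_w2 : H_w2 f.
Proof.
pose g (p : R * R) := majorant (p.1 + p.2).
have g_le d1 d2 : 0 <= d1 -> 0 <= d2 ->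
    (w2 g d1 d2 <= (majorant (d1 + d2))%:E)%E.
  move=> d10 d20; apply: ge_ereal_sup => _ [p [q [[p1 p2] [q1 q2] h1 h2 ->]]].
  rewrite lee_fin; move: h1 h2; rewrite !ler_norml => /andP[? ?] /andP[? ?].
  have : g p <= g q + majorant (d1 + d2) by apply: majorant_subadd; lra.
  have : g q <= g p + majorant (d1 + d2) by apply: majorant_subadd; lra.
  by move=> ? ?; apply/andP; split; lra.
have g_ge d1 d2 : 0 <= d1 -> 0 <= d2 ->
    ((majorant (d1 + d2))%:E <= w2 g d1 d2)%E.
  move=> d10 d20; apply: ereal_sup_ubound; exists (d1, d2), (0, 0).
  split; rewrite /K/g/= ?subr0 ?ger0_norm//.
    by rewrite addr0 majorant0 subr0.
  by rewrite addr0 majorant0 subr0 majorant_ge0 ?addr_ge0.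
exists g => [|u v x y Kp Kq].
  apply: (@squeeze_cvge _ _ _ R (fun=> 0%E) _
    (fun d => (majorant (d.1 + d.2))%:E)).
  - exists ([set d | 0 < d], [set d | 0 < d]) => /=.
      by split; exact: nbhs_right_gt.
    move=> -[d1 d2] /= [/ltW d10 /ltW d20]; rewrite g_le// andbT.
    by apply: le_trans (g_ge _ _ d10 d20); rewrite lee_fin majorant_ge0 ?addr_ge0.
  - exact: cvg_cst.
  - apply/fine_cvgP; split; first exact: nearW.
    apply/cvgr0Pnorm_lt => e e0; have [d d0 hd] := majorant_cvg0 e0.
    exists ([set x | 0 < x /\ x < d / 2], [set x | 0 < x /\ x < d / 2]) => /=.
      by split; apply: filterI;
        (exact: nbhs_right_gt || (apply: nbhs_right_lt; lra)).
    move=> -[d1 d2] /= [[? ?] [? ?]].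
    by rewrite ger0_norm ?majorant_ge0//; [apply: hd; lra|lra].
apply: le_trans (g_ge _ _ (normr_ge0 _) (normr_ge0 _)).
by rewrite lee_fin; exact: (le_majorant Kp Kq).
Qed.

End Majorant.

(** * Linear combinations and test functions in [H_w2] *)

Lemma almost_lipschitzZ (R : realType) (a : R) (f : R * R -> R) :
  almost_lipschitz f -> almost_lipschitz (fun p => a * f p).
Proof.
(* [|a| + 1] replaces [|a|] so that division is possible when [a] is 0. *)
move=> fL e e0; have a1 : 0 < `|a| + 1 by have := normr_ge0 a; lra.
have [C C0 fC] := fL _ (divr_gt0 e0 a1).
exists ((`|a| + 1) * C) => [|p q Kp Kq]; first by rewrite mulr_ge0// ltW.
rewrite -mulrBr normrM; apply: (@le_trans _ _ ((`|a| + 1) * `|f p - f q|)).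
  by rewrite ler_wpM2r// lerDl.
rewrite -mulrA -ler_pdivlMl// mulrDr mulKf ?lt0r_neq0// [_^-1 * _]mulrC.
exact: fC.
Qed.

Lemma almost_lipschitzD (R : realType) (f g : R * R -> R) :
  almost_lipschitz f -> almost_lipschitz g ->
  almost_lipschitz (fun p => f p + g p).
Proof.
move=> fL gL e e0; have e2 : 0 < e / 2 by lra.
have [C C0 fC] := fL _ e2; have [D D0 gD] := gL _ e2.
exists (C + D) => [|p q Kp Kq]; first exact: addr_ge0.
have := fC _ _ Kp Kq; have := gD _ _ Kp Kq; rewrite mulrDl => h1 h2.
rewrite (_ : _ - _ = (f p - f q) + (g p - g q)); last by ring.
by apply: (le_trans (ler_normD _ _)); lra.
Qed.

Lemma H_w2P (R : realType) (f : R * R -> R) : H_w2 f <-> almost_lipschitz f.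
Proof.
by split; [exact: H_w2_almost_lipschitz|exact: almost_lipschitz_H_w2].
Qed.

Lemma H_w2_f0 (R : realType) : H_w2 (@f0 R).
Proof.
apply/H_w2P => e e0; exists 0 => // p q _ _.
by rewrite mul0r addr0 subrr normr0 ltW.
Qed.

Lemma H_w2_f1 (R : realType) : H_w2 (@f1 R).
Proof.
apply/H_w2P => e e0; exists 1 => // p q _ _.
by rewrite mul1r; have := normr_ge0 (f2 p - f2 q); lra.
Qed.

Lemma H_w2_f2 (R : realType) : H_w2 (@f2 R).
Proof.
apply/H_w2P => e e0; exists 1 => // p q _ _.
by rewrite mul1r; have := normr_ge0 (f1 p - f1 q); lra.
Qed.

Lemma H_w2_f3 (R : realType) : H_w2 (@f3 R).
Proof.
apply/H_w2P => e e0; exists 2 => // p q Kp Kq.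
have /andP[? ?] := f1_itv Kp; have /andP[? ?] := f1_itv Kq.
have /andP[? ?] := f2_itv Kp; have /andP[? ?] := f2_itv Kq.
have sq (a b : R) : 0 <= a -> a < 1 -> 0 <= b -> b < 1 ->
    `|a ^+ 2 - b ^+ 2| <= 2 * `|a - b|.
  move=> *; rewrite subr_sqr normrM mulrC ler_wpM2r//.
  by rewrite ger0_norm; lra.
rewrite mulrDr; apply: (ler_wpDl (ltW e0)).
rewrite (_ : f3 p - f3 q = (f1 p ^+ 2 - f1 q ^+ 2) + (f2 p ^+ 2 - f2 q ^+ 2)).
  by apply: (le_trans (ler_normD _ _)); apply: lerD; exact: sq.
by rewrite /f3 /f1 /f2; ring.
Qed.

Lemma H_w2_lincomb (R : realType) (a b : R) (f g : R * R -> R) :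
  H_w2 f -> H_w2 g -> H_w2 (fun p => a * f p + b * g p).
Proof.
move=> /H_w2P fL /H_w2P gL; apply/H_w2P.
by apply: almost_lipschitzD; exact: almost_lipschitzZ.
Qed.

(** * Boundedness and Korovkin's estimate *)

Lemma H_w2_bounded (R : realType) (f : R * R -> R) : H_w2 f ->
  exists M : R, forall p, K p -> `|f p| <= M.
Proof.
move=> /H_w2P /(_ _ ltr01)[C C0 fC]; exists (`|f (0, 0)| + 1 + 2 * C) => p Kp.
have K0 : K (0 : R, 0 : R) by [].
have /andP[? ?] := f1_itv Kp; have /andP[? ?] := f1_itv K0.
have /andP[? ?] := f2_itv Kp; have /andP[? ?] := f2_itv K0.
have d1 : `|f1 p - f1 (0, 0)| <= 1 by rewrite ler_norml; lra.
have d2 : `|f2 p - f2 (0, 0)| <= 1 by rewrite ler_norml; lra.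
have := fC _ _ Kp K0; have := lerB_dist (f p) (f (0, 0)).
have : C * (`|f1 p - f1 (0, 0)| + `|f2 p - f2 (0, 0)|) <= C * 2.
  by rewrite ler_wpM2l//; lra.
by lra.
Qed.

(* AM-GM makes the linear term of almost_lipschitz quadratic, so that the bound
   becomes a combination of f0, ..., f3 in q. *)
Lemma H_w2_quadratic (R : realType) (f : R * R -> R) : H_w2 f ->
  forall e : R, 0 < e -> exists2 C : R, 0 <= C & forall p q, K p -> K q ->
    `|f q - f p| <= e + C * ((f1 q - f1 p) ^+ 2 + (f2 q - f2 p) ^+ 2).
Proof.
move=> /H_w2P fL e e0; have e2 : 0 < e / 2 by lra.
have [C C0 fC] := fL _ e2; exists (C ^+ 2 / e) => [|p q Kp Kq].
  by rewrite divr_ge0 ?sqr_ge0// ltW.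
(* The two coordinates cost e/4 each, which with the e/2 from [fC] stays within [e]. *)
have am (a : R) : C * `|a| <= e / 4 + C ^+ 2 / e * a ^+ 2.
  rewrite -(real_normK (num_real a)) -subr_ge0.
  rewrite (_ : _ - _ = (e / 2 - C * `|a|) ^+ 2 / e).
    by rewrite divr_ge0 ?sqr_ge0 ?ltW.
  by field; exact: lt0r_neq0.
have := fC _ _ Kq Kp; rewrite !mulrDr.
by have := am (f1 q - f1 p); have := am (f2 q - f2 p); lra.
Qed.

(** A real [sup] is an upper bound only for a bounded set; here [L f] is bounded by [C_B] and [f] by
    [H_w2_bounded]. *)
Lemma supnorm_ub (R : realType) (L : (R * R -> R) -> (R * R -> R))
    (f : R * R -> R) : positive_linear_operator L -> H_w2 f ->
  forall p, K p -> `|L f p - f p| <= supnorm (L f \- f).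
Proof.
move=> L_op fH p Kp; apply: ub_le_sup; last by exists p.
have [LC _ _] := L_op; have [_ [M LM]] := LC _ fH.
have [N fN] := H_w2_bounded fH.
exists (M + N) => _ [q Kq <-]; apply: (le_trans (ler_normB _ _)).
by apply: lerD; [exact: LM|exact: fN].
Qed.

(** [B] is chosen before [L] and [p], hence serves all operators of the sequence at once. *)
Lemma korovkin_pointwise (R : realType) (f : R * R -> R) : H_w2 f ->
  forall e : R, 0 < e -> exists2 B : R, 0 <= B &
  forall L, positive_linear_operator L -> forall p, K p ->
    `|L f p - f p| <= e + B * (`|L f0 p - f0 p| + `|L f1 p - f1 p|
                               + `|L f2 p - f2 p| + `|L f3 p - f3 p|).
Proof.
move=> fH e e0; have [C C0 fC] := H_w2_quadratic fH e0.
have [M fM] := H_w2_bounded fH.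
have f0H := H_w2_f0 R; have f1H := H_w2_f1 R.
have f2H := H_w2_f2 R; have f3H := H_w2_f3 R.
have M0 : 0 <= M.
  by apply: le_trans (fM (0, 0) _) => //; rewrite /K/=; split.
(* This dominates every error coefficient: |f p| + e + C f3 p for [f0], at most 2C for [f1] and
   [f2], and C for [f3]. *)
exists (M + e + 2 * C) => [|L [_ L_lin L_pos] p Kp]; first by lra.
have /andP[s0 s1] := f1_itv Kp; have /andP[t0 t1] := f2_itv Kp.
have f3E (q : R * R) : f3 q = f1 q ^+ 2 + f2 q ^+ 2 by [].
have f0E (q : R * R) : f0 q = 1 by [].
(* Taking c = 1 and c = -1 yields both sides of the absolute value. *)
have upper (c : R) : `|c| = 1 ->
    c * (L f p - f p * L f0 p) <= e * L f0 p
      + C * (L f3 p - 2 * f1 p * L f1 p - 2 * f2 p * L f2 p + f3 p * L f0 p).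
  move=> c1; rewrite -subr_ge0.
  have h01 := H_w2_lincomb (e + C * f3 p + c * f p) (- (2 * C * f1 p)) f0H f1H.
  have h23 := H_w2_lincomb (- (2 * C * f2 p)) C f2H f3H.
  have h03 := H_w2_lincomb 1 1 h01 h23.
  have hH := H_w2_lincomb 1 (- c) h03 fH.
  (* The factors 1 reproduce the shape of [hH], so that [L_lin] can expand the image under [L]. *)
  have : forall q, K q -> 0 <= 1 * (1 * ((e + C * f3 p + c * f p) * f0 q
      + (- (2 * C * f1 p)) * f1 q) + 1 * ((- (2 * C * f2 p)) * f2 q + C * f3 q))
      + (- c) * f q.
    move=> q Kq; have fpq := fC p q Kp Kq.
    have : c * (f q - f p) <= `|f q - f p|.
      by apply: (le_trans (ler_norm _)); rewrite normrM c1 mul1r.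
    move: fpq; move: `|f q - f p| => b.
    by rewrite !f3E f0E; lra.
  move=> /(L_pos _ hH) /(_ p Kp); rewrite !L_lin//.
  by lra.
have := upper 1 (normr1 _); have := upper (-1) (normrN1 _).
(* Writing L fi = fi + ai, the main quadratic terms cancel: 2 f3 = 2 f1^2 + 2 f2^2 at [p]. Only [e]
   and multiples of the ai remain. *)
set a0 := L f0 p - f0 p; set a1 := L f1 p - f1 p.
set a2 := L f2 p - f2 p; set a3 := L f3 p - f3 p.
have -> : L f0 p = 1 + a0 by rewrite /a0 f0E; ring.
have -> : L f1 p = f1 p + a1 by rewrite /a1; ring.
have -> : L f2 p = f2 p + a2 by rewrite /a2; ring.
have -> : L f3 p = f3 p + a3 by rewrite /a3; ring.
have mulb (m x b : R) : `|m| <= b -> m * x <= b * `|x|.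
  move=> mb; apply: (le_trans (ler_norm _)).
  by rewrite normrM ler_wpM2r.
have {M0} B0 : 0 <= M + e + 2 * C by lra.
have Cs : 0 <= C * f1 p <= C by rewrite mulr_ge0//= ler_piMr// ltW.
have Ct : 0 <= C * f2 p <= C by rewrite mulr_ge0//= ler_piMr// ltW.
have Cq : 0 <= C * f3 p <= 2 * C.
  rewrite mulr_ge0//= ?[2 * C]mulrC ?ler_wpM2l// f3E ?addr_ge0 ?sqr_ge0//.
  have := expr_le1 (isT : (0 < 2)%N) s0; have := expr_le1 (isT : (0 < 2)%N) t0.
  by rewrite (ltW s1) (ltW t1); lra.
have FM := fM _ Kp; have M0 : 0 <= M by apply: le_trans FM.
have := mulb (f p) a0 M FM; have := mulb (- f p) a0 M; rewrite normrN => /(_ FM).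
have := mulb (e + C * f3 p) a0 (e + 2 * C).
rewrite ger0_norm; last by lra.
move=> /(_ ltac:(lra)).
have := mulb (- (2 * (C * f1 p))) a1 (M + e + 2 * C).
rewrite normrN ger0_norm; last by lra.
move=> /(_ ltac:(lra)).
have := mulb (- (2 * (C * f2 p))) a2 (M + e + 2 * C).
rewrite normrN ger0_norm; last by lra.
move=> /(_ ltac:(lra)).
have := mulb C a3 (M + e + 2 * C); rewrite ger0_norm// => /(_ ltac:(lra)).
rewrite ler_norml !f3E.
move: `|a0| `|a1| `|a2| `|a3| => n0 n1 n2 n3 *.
by apply/andP; split; lra.
Qed.

(** * Sets of [A]-density zero *)

Section Density.
Variables (R : realType) (A : nat -> nat -> R).
Hypothesis A_ge0 : forall j n, 0 <= A j n.
Hypothesis A_regular : regular_matrix A.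

(** [A_stat_cvg A x 0] asks this of each set of indices where |x n - 0| >= e. *)
Definition null_density (P : pred nat) : Prop :=
  (fun j => limn (fun N => \sum_(0 <= n < N | P n) A j n)) @ \oo --> (0 : R).

Lemma row_sum_nondecreasing (P : pred nat) (j : nat) :
  {homo (fun N => \sum_(0 <= n < N | P n) A j n) : m n / (m <= n)%N >-> m <= n}.
Proof.
apply/nondecreasing_seqP => n; rewrite [leRHS]big_mkcond big_nat_recr//= -big_mkcond.
by rewrite lerDl; case: (P n).
Qed.

Lemma row_sum_cvg (P : pred nat) (j : nat) :
  cvgn (fun N => \sum_(0 <= n < N | P n) A j n).
Proof.
apply: nondecreasing_is_cvgn; first exact: row_sum_nondecreasing.
(* Regularity applied to the constant sequence 1 makes each full row summable; partial rows are then
   bounded by it. *)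
have [/(_ j) rowA _] := A_regular (cvg_cst (1 : R)).
have {}rowA : cvgn (fun N => \sum_(0 <= n < N) A j n).
  by under eq_fun do under eq_bigr do rewrite -[A _ _]mulr1.
exists (limn (fun N => \sum_(0 <= n < N) A j n)) => _ [N _ <-].
apply: le_trans (nondecreasing_cvgn_le (@row_sum_nondecreasing xpredT j) rowA N).
by rewrite big_mkcond; apply: ler_sum => n _; case: (P n).
Qed.

Lemma null_density_sub (P Q : pred nat) :
  (forall n, P n -> Q n) -> null_density Q -> null_density P.
Proof.
move=> PQ Q0; rewrite /null_density; apply: (squeeze_cvgr _ (cvg_cst (0 : R)) Q0).
apply: nearW => j; apply/andP; split.
  by apply: limr_ge; [exact: row_sum_cvg|apply: nearW => N; apply: sumr_ge0].
apply: ler_lim; [exact: row_sum_cvg|exact: row_sum_cvg|apply: nearW => N].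
rewrite big_mkcond [leRHS]big_mkcond; apply: ler_sum => n _.
by have := PQ n; case: (P n) => [->//|_]; case: (Q n).
Qed.

(** The indicator of a union is at most the sum of the indicators, so the row sums are squeezed. *)
Lemma null_densityU (P Q : pred nat) :
  null_density P -> null_density Q -> null_density (predU P Q).
Proof.
move=> Pn Qn.
have PQ0 : (fun j => limn (fun N => \sum_(0 <= n < N | P n) A j n)
    + limn (fun N => \sum_(0 <= n < N | Q n) A j n)) @ \oo --> (0 : R).
  by have := cvgD Pn Qn; rewrite addr0; exact.
rewrite /null_density; apply: (squeeze_cvgr _ (cvg_cst (0 : R)) PQ0).
apply: nearW => j; apply/andP; split.
  by apply: limr_ge; [exact: row_sum_cvg|apply: nearW => N; apply: sumr_ge0].
rewrite -limD; [|exact: row_sum_cvg|exact: row_sum_cvg].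
apply: ler_lim; [exact: row_sum_cvg|by apply: is_cvgD; exact: row_sum_cvg|].
apply: nearW => N; rewrite [leRHS]/GRing.add/=.
rewrite big_mkcond [X in _ <= X + _]big_mkcond [X in _ <= _ + X]big_mkcond -big_split.
apply: ler_sum => n _ /=; have := A_ge0 j n.
by case: (P n); case: (Q n) => /=; lra.
Qed.

Lemma A_stat_cvg_le (x y : nat -> R) :
  (forall e, 0 < e -> exists2 d, 0 < d & forall n, `|y n| < d -> `|x n| < e) ->
  A_stat_cvg A y 0 -> A_stat_cvg A x 0.
Proof.
move=> xy y0 e /xy[d d0 dxy]; apply: null_density_sub (y0 d d0) => n.
by rewrite !subr0 !leNgt; apply: contra => /dxy.
Qed.

Lemma A_stat_cvgD (x y : nat -> R) :
  A_stat_cvg A x 0 -> A_stat_cvg A y 0 -> A_stat_cvg A (fun n => x n + y n) 0.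
Proof.
move=> x0 y0 e e0; have e2 : 0 < e / 2 by lra.
apply: null_density_sub (null_densityU (x0 _ e2) (y0 _ e2)) => n /=.
rewrite !subr0; have := ler_normD (x n) (y n).
by case: leP => //= ? ? ?; lra.
Qed.

End Density.

(** * From the uniform estimate to statistical convergence *)

Theorem theorem2p1 (R : realType) (A : nat -> nat -> R)
    (L : nat -> (R * R -> R) -> (R * R -> R))
    (A_ge0 : forall j n, 0 <= A j n)
    (A_regular : regular_matrix A)
    (L_op : forall n, positive_linear_operator (L n))
    (L_f0 : A_stat_cvg A (fun n => supnorm (L n f0 \- f0)) 0)
    (L_f1 : A_stat_cvg A (fun n => supnorm (L n f1 \- f1)) 0)
    (L_f2 : A_stat_cvg A (fun n => supnorm (L n f2 \- f2)) 0)
    (L_f3 : A_stat_cvg A (fun n => supnorm (L n f3 \- f3)) 0) :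
  forall f : R * R -> R, H_w2 f ->
    A_stat_cvg A (fun n => supnorm (L n f \- f)) 0.
Proof.
move=> f fH.
have K0 : K (0 : R, 0 : R) by [].
have := A_stat_cvgD A_ge0 A_regular (A_stat_cvgD A_ge0 A_regular
  (A_stat_cvgD A_ge0 A_regular L_f0 L_f1) L_f2) L_f3.
apply: A_stat_cvg_le => // e e0.
have [B B0 fB] := korovkin_pointwise fH (divr_gt0 e0 (ltr0n R 2)).
(* If S < e/2/(B + 1) then B S < e/2; the 1 covers B = 0. *)
exists (e / 2 / (B + 1)) => [|n]; first by rewrite !divr_gt0//; lra.
move=> small.
have n0 := supnorm_ub (L_op n) (H_w2_f0 R).
have n1 := supnorm_ub (L_op n) (H_w2_f1 R).
have n2 := supnorm_ub (L_op n) (H_w2_f2 R).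
have n3 := supnorm_ub (L_op n) (H_w2_f3 R).
set S := _ + _ + _ + _ in small.
have : supnorm (L n f \- f) <= e / 2 + B * S.
  apply: ge_sup; first by exists `|L n f (0, 0) - f (0, 0)|, (0, 0).
  move=> _ [p Kp <-]; apply: (le_trans (fB _ (L_op n) p Kp)).
  rewrite lerD2l ler_wpM2l//.
  by rewrite !lerD ?n0 ?n1 ?n2 ?n3.
have S0 : 0 <= S.
  by rewrite !addr_ge0// (le_trans (normr_ge0 _) (n0 _ K0), le_trans (normr_ge0 _) (n1 _ K0),
    le_trans (normr_ge0 _) (n2 _ K0), le_trans (normr_ge0 _) (n3 _ K0)).
have sup0 : 0 <= supnorm (L n f \- f).
  exact: (le_trans (normr_ge0 _) (supnorm_ub (L_op n) fH K0)).
move: small; rewrite ger0_norm// ltr_pdivlMr; last by lra.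
by rewrite ger0_norm//; lra.
Qed.
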